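(* Let $G=(V,E)$ be a finite, connected, non-bipartite graph without multiple edges and self-loops, let $D$ be an integer such that $3\le D(x)\le D$ for all $x\in V$, where $D(x)$ is the degree of $x$, and let $\beta>0$. Assume that the spectrum of $P^2$ on $\ell^2_o(V,\pi)$ is contained in $[0,1-\beta]$. Then for all integers $n\ge 1$, $$\|\mathcal{S}^n\|_{\ell^2_o(B,U)\to\ell^2_o(B,U)}\le (1-c(D,\beta))^{\lfloor n/4\rfloor},$$ where, with $Q=D-1$, $$c(D,\beta)=\min\left(\frac{Q^{-4}\beta}{2(1+Q^{-4}\beta/6)^{2}},\;\frac{Q^{-4}\beta}{(1+6Q^4/\beta)^{2}}\right).$$
   Context: For vertices, $y\sim x$ means that $y$ is a neighbour of $x$. The measure $\pi$ on $V$ is $\pi(x)=D(x)$, and the operator $P$ on $\mathbb{C}^V$ is $Pf(x)=\frac{1}{D(x)}\sum_{y\sim x}f(y)$; it is self-adjoint on $\ell^2(V,\pi)$. $\ell^2_o(V,\pi)$ is the space of functions orthogonal to constants in $\ell^2(V,\pi)$; it is preserved by $P$. $B$ is the set of oriented edges of $G$ (each edge of $E$ gives two oriented edges), endowed with the uniform measure $U$ giving weight $1$ to each oriented edge. For $e\in B$, $o(e)$ is its origin and $t(e)$ its terminus. For $e,e'\in B$, $e'\leadsto e$ means that $t(e')=o(e)$ and $e$ is not the reverse of $e'$. The operator $\mathcal{S}$ on $\ell^2(B,U)$ is $\mathcal{S}f(e)=\frac{1}{D(o(e))-1}\sum_{e'\leadsto e}f(e')$. $\ell^2_o(B,U)$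 is the space of functions orthogonal to constants in $\ell^2(B,U)$; it is preserved by $\mathcal{S}$. *)

(* Defs.v *)
From mathcomp Require Import all_boot all_order all_algebra.
From mathcomp Require Import all_classical all_reals all_analysis.
From mathcomp Require Import complex.

Set Implicit Arguments.
Unset Strict Implicit.
Unset Printing Implicit Defensive.

Import Order.TTheory GRing.Theory Num.Theory.

Local Open Scope classical_set_scope.
Local Open Scope ring_scope.

Section WeightedL2.
Variables (R : realType) (T : finType) (mu : T -> R).

Implicit Types (f g : {ffun T -> R[i]}) (A : {ffun T -> R[i]} -> {ffun T -> R[i]}).

Definition l2inner f g : R[i] := \sum_x ((mu x)%:C%C * f x * (g x)^*%C).

Definition l2norm f : R := Num.sqrt (\sum_x mu x * Normc.normc (f x) ^+ 2).

Definition l2o : set {ffun T -> R[i]} :=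
  [set f | forall a : R[i], l2inner f [ffun=> a] = 0].

(* Spectrum of the restriction of A to a subspace W that A preserves. Function
   spaces here are finite-dimensional, so a bijective A - lambda automatically
   has a bounded inverse. *)
Definition spectrum_on (W : set {ffun T -> R[i]}) A : set R[i] :=
  [set lambda | ~ set_bij W W (fun f => A f - lambda *: f)].

(* Taken in \bar R, so that the supremum has no junk value. *)
Definition opnorm_on (W : set {ffun T -> R[i]}) A : \bar R :=
  ereal_sup [set (l2norm (A f))%:E | f in W `&` [set f | l2norm f <= 1]].

End WeightedL2.

(* A simple graph on V is a symmetric irreflexive relation adj. *)
Section Graph.
Variables (V : finType) (adj : rel V).

Definition deg (x : V) : nat := #|[pred y | adj x y]|.

Definition connected_graph : Prop := forall x y : V, connect adj x y.

Definition bipartite : Prop :=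
  exists side : V -> bool, forall x y, adj x y -> side x != side y.

Definition oedge : finType := {e : V * V | adj e.1 e.2}.

Definition origin (e : oedge) : V := (val e).1.

Definition terminus (e : oedge) : V := (val e).2.

Definition is_reverse (e e' : oedge) : bool :=
  (origin e == terminus e') && (terminus e == origin e').

Definition leadsto (e' e : oedge) : bool :=
  (terminus e' == origin e) && ~~ is_reverse e e'.

Variable R : realType.

Definition pi_meas (x : V) : R := (deg x)%:R.

Definition U_meas (e : oedge) : R := 1.

Definition Pop (f : {ffun V -> R[i]}) : {ffun V -> R[i]} :=
  [ffun x => ((deg x)%:R)^-1 * \sum_(y | adj x y) f y].

Definition Sop (f : {ffun oedge -> R[i]}) : {ffun oedge -> R[i]} :=
  [ffun e => ((deg (origin e))%:R - 1)^-1 * \sum_(e' | leadsto e' e) f e'].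

End Graph.

Arguments U_meas {V} adj R e.
Arguments pi_meas {V} adj R x.
Arguments Pop {V} adj {R} f.
Arguments Sop {V} adj {R} f.

Definition cDbeta (R : realType) (D : nat) (beta : R) : R :=
  let Q : R := D%:R - 1 in
  Num.min (Q ^- 4 * beta / (2 * (1 + Q ^- 4 * beta / 6) ^+ 2))
          (Q ^- 4 * beta / (1 + 6 * Q ^+ 4 / beta) ^+ 2).

(* Main.v *)
(* Write [f = g o t + u] where [g x] is the mean of [f] over the edges ending at
   [x], and [N] for the squared norm on edges, so that [N f = |g|_pi^2 + N u].
   Then [S f = g o o + w], where [w] has mean zero over the edges leaving each
   vertex and [N w <= N u / 4]; hence [N (S f) <= |g|_pi^2 + N u / 4].  The mean
   of [g o o] over the edges ending at [x] is [P g x], so the spectral gap of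
   [P^2] makes [S] contract [g o o] by the factor [1 - 3 beta / 4] in squared
   norm.  Balancing the two effects gives
   [N (S^2 f) <= (1 - 3 beta^2 / 16) N f] for [f] orthogonal to constants, and
   [c(D, beta) <= 3 beta^2 / 16] because [beta <= 1].  As [S] and [P] are real,
   the edge estimates are proved for real functions. *)
Require Import Defs.
From mathcomp Require Import all_boot all_order all_algebra.
From mathcomp Require Import all_classical all_reals all_analysis.
From mathcomp Require Import complex spectral sesquilinear.
From mathcomp Require Import ring lra.

Set Implicit Arguments.
Unset Strict Implicit.
Unset Printing Implicit Defensive.

Import Order.TTheory GRing.Theory Num.Theory.

Local Open Scope classical_set_scope.
Local Open Scope ring_scope.
Local Open Scope sesquilinear_scope.

(** * Averages, fluctuations and energy estimates on oriented edges *)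

Section NonBacktracking.
Variables (R : realType) (V : finType) (adj : rel V).
Hypothesis adj_sym : symmetric adj.
Hypothesis deg_ge3 : forall x, (3 <= deg adj x)%N.

Local Notation E := (oedge adj).
Implicit Types (f g h : E -> R) (e : E) (x y : V).

Let d x : R := (deg adj x)%:R.

Let d_ge3 x : 3 <= d x.
Proof. by rewrite /d ler_nat. Qed.

Lemma rev_subproof e : adj (terminus e, origin e).1 (terminus e, origin e).2.
Proof. by rewrite /= adj_sym; exact: (valP e). Qed.

Definition rev e : E := Sub (terminus e, origin e) (rev_subproof e).

Lemma origin_rev e : origin (rev e) = terminus e.
Proof. by rewrite /rev /origin SubK. Qed.

Lemma terminus_rev e : terminus (rev e) = origin e.
Proof. by rewrite /rev /terminus SubK. Qed.

Lemma revK : involutive rev.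
Proof.
move=> e; apply: val_inj; rewrite /rev SubK origin_rev terminus_rev.
by rewrite /origin /terminus -surjective_pairing.
Qed.

Lemma is_reverseE e e' : is_reverse e e' = (e' == rev e).
Proof.
rewrite /is_reverse -val_eqE /rev SubK /origin /terminus.
case: (val e) (val e') => [a b] [a' b'] /=.
by rewrite xpair_eqE andbC (eq_sym b) (eq_sym a).
Qed.

Lemma sum_origin x (F : V -> R) :
  \sum_(e : E | origin e == x) F (terminus e) = \sum_(y | adj x y) F y.
Proof.
rewrite -(big_sub_cond [pred p : V * V | adj p.1 p.2] [pred p | p.1 == x]
  (fun p => F p.2)) /=.
rewrite (eq_bigl (fun p : V * V => (p.1 == x) && adj p.1 p.2)); last first.
  by move=> p; rewrite andbC.
rewrite -(pair_big_dep (pred1 x) adj (fun _ y => F y)) /=.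
by rewrite big_pred1_eq.
Qed.

Lemma sum_terminus x (F : V -> R) :
  \sum_(e : E | terminus e == x) F (origin e) = \sum_(y | adj x y) F y.
Proof.
rewrite -sum_origin (reindex_inj (inv_inj revK)) /=.
by apply: eq_big => [e|e _]; rewrite ?terminus_rev ?origin_rev.
Qed.

Lemma sum_deg_origin (F : V -> R) :
  \sum_(e : E) F (origin e) = \sum_x d x * F x.
Proof.
rewrite (partition_big (@origin _ adj) xpredT) //=; apply: eq_bigr => x _.
rewrite (eq_bigr (fun=> F x)) => [|e /eqP-> //].
by rewrite (sum_origin x (fun=> F x)) sumr_const -mulr_natl.
Qed.

Lemma sum_deg_terminus (F : V -> R) :
  \sum_(e : E) F (terminus e) = \sum_x d x * F x.
Proof.
rewrite -sum_deg_origin (reindex_inj (inv_inj revK)) /=.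
by apply: eq_bigr => e _; rewrite terminus_rev.
Qed.

Definition nbw f e : R :=
  (d (origin e) - 1)^-1 * \sum_(e' | leadsto e' e) f e'.

Definition inavg f x : R := (d x)^-1 * \sum_(e | terminus e == x) f e.

(** This is the [w] of the decomposition: dropping the single term [f (rev e)] from a sum with mean
    [inavg f (origin e)] shifts the mean by this amount. *)
Definition fluct f e : R :=
  (d (origin e) - 1)^-1 * (inavg f (origin e) - f (rev e)).

Definition energy f : R := \sum_e f e ^+ 2.

Definition avg_energy f : R := \sum_x d x * inavg f x ^+ 2.

Lemma deg_inavg f x : d x * inavg f x = \sum_(e | terminus e == x) f e.
Proof.
by rewrite /inavg mulrA divff ?mul1r // gt_eqF // (lt_le_trans _ (d_ge3 x)).
Qed.

Lemma sum_deg_inavg f : \sum_x d x * inavg f x = \sum_e f e.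
Proof.
rewrite [RHS](partition_big (@terminus _ adj) xpredT) //=.
by apply: eq_bigr => x _; rewrite deg_inavg.
Qed.

Lemma nbwE f e : nbw f e = inavg f (origin e) + fluct f e.
Proof.
have d3 := d_ge3 (origin e).
rewrite /nbw; have -> : \sum_(e' | leadsto e' e) f e' =
    d (origin e) * inavg f (origin e) - f (rev e).
  (* The edges ending at [origin e] are those leading to [e], together with [rev e]. *)
  rewrite deg_inavg [in RHS](bigD1 (rev e)) ?terminus_rev //= addrAC subrr add0r.
  by apply: eq_bigl => e'; rewrite /leadsto is_reverseE.
rewrite /fluct; field.
by apply: lt0r_neq0; lra.
Qed.

(** Reversal carries the edges leaving [x] to those ending at [x], where [f] has mean [inavg f x].
    The weight [F] turns this into orthogonality to every function of the origin once [x] varies. *)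
Lemma sum_fluct f x (F : V -> R) :
  \sum_(e | origin e == x) F (origin e) * fluct f e = 0.
Proof.
rewrite (eq_bigr (fun e => F x * (d x - 1)^-1 * (inavg f x - f (rev e))));
  last by move=> e /eqP <-; rewrite /fluct mulrA.
rewrite -mulr_sumr big_split /= sumrN.
rewrite (sum_origin x (fun=> inavg f x)) sumr_const -mulr_natl.
have -> : \sum_(e : E | origin e == x) f (rev e) = d x * inavg f x.
  rewrite deg_inavg [RHS](reindex_inj (inv_inj revK)) /=.
  by apply: eq_bigl => e; rewrite terminus_rev.
by apply/eqP; rewrite mulf_eq0 subr_eq0 eqxx orbT.
Qed.

Lemma sum_origin_fluct f (F : V -> R) :
  \sum_e F (origin e) * fluct f e = 0.
Proof.
rewrite (partition_big (@origin _ adj) xpredT) //=.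
by rewrite big1 // => x _; exact: sum_fluct.
Qed.

Lemma sum_nbw f : \sum_e nbw f e = \sum_e f e.
Proof.
rewrite (eq_bigr _ (fun e _ => nbwE f e)) big_split /=.
have -> : \sum_e fluct f e = 0.
  by rewrite -[RHS](sum_origin_fluct f (fun=> 1)); apply: eq_bigr => e _; rewrite mul1r.
by rewrite addr0 (sum_deg_origin (inavg f)) sum_deg_inavg.
Qed.

(** Pythagoras: [inavg f] composed with [terminus] is the orthogonal projection of [f] onto the
    functions of the terminus. *)
Lemma energy_dev f :
  \sum_e (f e - inavg f (terminus e)) ^+ 2 = energy f - avg_energy f.
Proof.
have cross : \sum_e f e * inavg f (terminus e) = avg_energy f.
  rewrite (partition_big (@terminus _ adj) xpredT) //=; apply: eq_bigr => x _.
  rewrite (eq_bigr (fun e => f e * inavg f x)) => [|e /eqP-> //].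
  by rewrite -mulr_suml -deg_inavg -mulrA -expr2.
have sq : \sum_(e : E) inavg f (terminus e) ^+ 2 = avg_energy f.
  exact: (sum_deg_terminus (fun x => inavg f x ^+ 2)).
under eq_bigr do rewrite sqrrB -mulr_natl.
by rewrite big_split sumrB /= -mulr_sumr cross sq /energy; ring.
Qed.

Lemma avg_energy_ge0 f : 0 <= avg_energy f.
Proof. by apply: sumr_ge0 => x _; rewrite mulr_ge0 ?sqr_ge0 ?ler0n. Qed.

Lemma avg_energy_le f : avg_energy f <= energy f.
Proof.
by rewrite -subr_ge0 -energy_dev; apply: sumr_ge0 => e _; exact: sqr_ge0.
Qed.

Lemma energy_lift f : energy (fun e => inavg f (origin e)) = avg_energy f.
Proof. exact: (sum_deg_origin (fun x => inavg f x ^+ 2)). Qed.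

(** After reversal, [fluct f] is, up to sign, the deviation of [f] from its mean divided by
    [d (terminus e) - 1], which is at least 2; squaring gives the factor 4. *)
Lemma energy_fluct f : energy (fluct f) <= (energy f - avg_energy f) / 4.
Proof.
rewrite -energy_dev mulr_suml /energy [leLHS](reindex_inj (inv_inj revK)) /=.
apply: ler_sum => e _; rewrite /fluct origin_rev revK.
have d3 := d_ge3 (terminus e).
rewrite exprMn mulrC -sqrrN opprB ler_wpM2l ?sqr_ge0 //.
have -> : (4 : R)^-1 = (2^-1) ^+ 2 by rewrite exprVn; congr (_^-1); ring.
have d2 : 0 < d (terminus e) - 1 by lra.
by apply: lerXn2r; rewrite ?nnegrE ?invr_ge0 ?(ltW d2) // lef_pV2 ?posrE //; lra.
Qed.

Lemma energy_nbw f :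
  energy (nbw f) <= avg_energy f + (energy f - avg_energy f) / 4.
Proof.
have -> : energy (nbw f) = avg_energy f + energy (fluct f).
  rewrite -energy_lift /energy.
  under eq_bigr do rewrite nbwE sqrrD -mulr_natl.
  rewrite !big_split /= -mulr_sumr.
  by rewrite (sum_origin_fluct f (inavg f)) mulr0 addr0.
by rewrite lerD2l energy_fluct.
Qed.

Lemma energy_nbw_le f : energy (nbw f) <= energy f.
Proof. by have := energy_nbw f; have := avg_energy_le f; lra. Qed.

Lemma nbwD f g e : nbw (fun e => f e + g e) e = nbw f e + nbw g e.
Proof. by rewrite /nbw big_split mulrDr. Qed.

(** Young's inequality with a free parameter: pointwise, the two sides differ by the square
    [s^-1 * (s * f e - g e) ^+ 2]. *)
Lemma energyD_le f g (s : R) : 0 < s ->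
  energy (fun e => f e + g e) <= (1 + s) * energy f + (1 + s^-1) * energy g.
Proof.
move=> s0; rewrite /energy !mulr_sumr -big_split; apply: ler_sum => e _ /=.
rewrite -subr_ge0.
have -> : (1 + s) * f e ^+ 2 + (1 + s^-1) * g e ^+ 2 - (f e + g e) ^+ 2 =
    s^-1 * (s * f e - g e) ^+ 2 by field; rewrite gt_eqF.
by rewrite mulr_ge0 ?sqr_ge0 // invr_ge0 ltW.
Qed.

Definition srw (g : V -> R) x : R := (d x)^-1 * \sum_(y | adj x y) g y.

Lemma inavg_lift (g : V -> R) x : inavg (fun e => g (origin e)) x = srw g x.
Proof. by rewrite /inavg /srw sum_terminus. Qed.

Lemma energy_nbw2 (b : R) : 0 < b <= 1 ->
  (forall g : V -> R, \sum_x d x * g x = 0 ->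
     \sum_x d x * srw g x ^+ 2 <= (1 - b) * \sum_x d x * g x ^+ 2) ->
  forall f, \sum_e f e = 0 ->
  energy (nbw (nbw f)) <= (1 - 3 / 16 * b ^+ 2) * energy f.
Proof.
move=> /andP[b0 b1] gap f f0.
pose G e := inavg f (origin e).
have -> : nbw (nbw f) = fun e => nbw G e + nbw (fluct f) e.
  apply/funext => e; rewrite -nbwD; congr (nbw _ e).
  by apply/funext => e'; rewrite nbwE.
set a := avg_energy f; set t := energy f.
have a0 : 0 <= a := avg_energy_ge0 f.
have at_ : a <= t := avg_energy_le f.
have GE : energy G = a by exact: energy_lift.
have aG : avg_energy G <= (1 - b) * a.
  rewrite /avg_energy /a; under eq_bigr do rewrite inavg_lift.
  by apply: gap; rewrite sum_deg_inavg.
have SG : energy (nbw G) <= (1 - 3 / 4 * b) * a.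
  by have := energy_nbw G; rewrite GE; lra.
have Sw : energy (nbw (fluct f)) <= (t - a) / 4.
  exact: le_trans (energy_nbw_le _) (energy_fluct f).
have bnd1 : energy (fun e => nbw G e + nbw (fluct f) e) <= a + (t - a) / 4.
  have -> : (fun e => nbw G e + nbw (fluct f) e) = nbw (nbw f).
    apply/funext => e; rewrite -nbwD; congr (nbw _ e).
    by apply/funext => e'; rewrite nbwE.
  exact: le_trans (energy_nbw_le _) (energy_nbw f).
(* The parameter [s = 3 / 8 * b] is half the loss in [SG], so that [(1 + s) * (1 - 2 * s) <= 1 - s]
   keeps half of the gain. *)
have s0 : 0 < 3 / 8 * b by rewrite mulr_gt0.
have bnd2 := energyD_le (nbw G) (nbw (fluct f)) s0.
set X := energy (fun e => _) in bnd1 bnd2 *.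
have SG' : (1 + 3 / 8 * b) * energy (nbw G) <= (1 - 3 / 8 * b) * a.
  apply: (@le_trans _ _ ((1 + 3 / 8 * b) * ((1 - 3 / 4 * b) * a))).
    by rewrite ler_wpM2l //; lra.
  by rewrite mulrA ler_wpM2r //; nra.
(* Multiplying by [b] clears the inverse of [s]; the factor [b + 8 / 3] stays bounded as [b] tends
   to 0. *)
have Sw' : b * ((1 + (3 / 8 * b)^-1) * energy (nbw (fluct f))) <=
    (b + 8 / 3) * ((t - a) / 4).
  have -> : b * ((1 + (3 / 8 * b)^-1) * energy (nbw (fluct f))) =
    (b + 8 / 3) * energy (nbw (fluct f)) by field; lra.
  by rewrite ler_wpM2l //; lra.
have bX : b * X <= b * ((1 - 3 / 8 * b) * a) + (b + 8 / 3) * ((t - a) / 4).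
  apply: le_trans (_ : b * (_ + _) <= _).
    by rewrite ler_wpM2l ?(ltW b0) //; exact: bnd2.
  rewrite mulrDr; apply: lerD => //.
  by rewrite ler_wpM2l ?(ltW b0).
have bnd1' : (1 - b / 2) * X <= (1 - b / 2) * (a + (t - a) / 4).
  by rewrite ler_wpM2l //; lra.
have ta : 0 <= t - a by lra.
(* The convex combination of [bnd2] and [bnd1] with weights [b / 2], [1 - b / 2]. *)
have b2 : b ^+ 2 <= 1 by rewrite expr2; nra.
(* In the combination the terms linear in [b] cancel: [a] gets exactly [1 - 3 / 16 * b ^+ 2], and
   [t - a] gets 7/12, which is below 13/16 and hence below the same factor. *)
have : 0 <= (1 - b ^+ 2) * (t - a) by rewrite mulr_ge0 //; lra.
move: bX bnd1'; rewrite expr2; lra.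
Qed.

End NonBacktracking.

(** * Hermitian forms, eigenvalues and spectrum *)

Lemma hermitian_form_le (C : numClosedFieldType) (n : nat) (A : 'M[C]_n) (b : C) :
  A \is hermsymmx -> (forall a, eigenvalue A a -> a <= b) ->
  forall v : 'rV[C]_n, (v *m A *m v^t*) 0 0 <= b * (v *m v^t*) 0 0.
Proof.
move=> /hermitian_normalmx/orthomx_spectralP EA eig v.
set P := spectralmx A in EA; set D := spectral_diag A in EA.
have PU : P \is unitarymx by exact: spectral_unitarymx.
have PA : P *m A = diag_mx D *m P.
  by rewrite {1}EA -mulmxA mulKVmx // unitarymx_unit.
(* Row [i] of the unitary [P] is an eigenvector for [D 0 i]; it is nonzero because it has norm 1. *)
have Db i : D 0 i <= b.
  apply: eig; apply/eigenvalueP; exists (row i P).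
    by rewrite -row_mul PA row_mul row_diag_mx -scalemxAl -rowE.
  apply/eqP => /(congr1 (fun w => w *m (row i P)^t*)).
  move/row_unitarymxP : (PU) => /(_ i i); rewrite dotmxE => P1.
  by rewrite mul0mx => /matrixP/(_ 0 0); rewrite P1 mxE eqxx => /eqP; rewrite oner_eq0.
(* In the eigenbasis coordinates [w], the form is the sum of the eigenvalues weighted by the squared
   moduli of the entries of [w]. *)
pose w := v *m P^t*.
have vE : v = w *m P by rewrite /w -invmx_unitary // mulmxKV // unitarymx_unit.
have wE : v^t* = P^t* *m w^t*.
  by rewrite vE trmx_mul map_mxM.
have -> : v *m v^t* = w *m w^t*.
  by rewrite wE /w !mulmxA.
have -> : v *m A *m v^t* = w *m diag_mx D *m w^t*.
  rewrite wE {1}vE -(mulmxA w) PA !mulmxA; congr (_ *m _).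
  by rewrite -!mulmxA (unitarymxP PU) mulmx1.
rewrite !mxE mulr_sumr; apply: ler_sum => i _.
rewrite mul_mx_diag !mxE mulrAC mulrC; apply: ler_wpM2r => //.
by rewrite mul_conjC_ge0.
Qed.

(** An eigenvector in [W] and 0 have the same image under [A - a], so injectivity fails. *)
Lemma eigen_in_spectrum (R : realType) (T : finType) (W : set {ffun T -> R[i]})
    (A : {ffun T -> R[i]} -> {ffun T -> R[i]}) (f : {ffun T -> R[i]}) (a : R[i]) :
  W 0 -> A 0 = 0 -> W f -> f != 0 -> A f = a *: f -> spectrum_on W A a.
Proof.
move=> W0 A0 Wf /negP f0 Af [_ inj _]; apply: f0; apply/eqP.
by apply: inj; rewrite ?inE // Af A0 scaler0 !subrr.
Qed.

Lemma l2o0 (R : realType) (T : finType) (mu : T -> R) : l2o mu 0.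
Proof.
by move=> a; rewrite /l2inner big1 // => x _; rewrite !ffunE mulr0 mul0r.
Qed.

Lemma Pop0 (R : realType) (V : finType) (adj : rel V) :
  Pop adj 0 = 0 :> {ffun V -> R[i]}.
Proof.
apply/ffunP => x; rewrite !ffunE big1 ?mulr0 // => y _.
by rewrite ffunE.
Qed.

(** * From the spectrum of [P^2] to a quadratic form inequality *)

Section SpectralGap.
Variables (R : realType) (V : finType) (adj : rel V).
Hypothesis adj_sym : symmetric adj.
Hypothesis deg_gt0 : forall x, (0 < deg adj x)%N.

Local Notation C := R[i].
Local Notation n := #|V|.
Local Notation W := (l2o (pi_meas adj R)).
Implicit Types (f g : {ffun V -> C}) (x y : V).

Let s x : C := (Num.sqrt (deg adj x)%:R : R)%:C%C.

Let s_sq x : s x * s x = (deg adj x)%:R.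
Proof. by rewrite /s -rmorphM -expr2 sqr_sqrtr ?ler0n // rmorph_nat. Qed.

Let s_neq0 x : s x != 0.
Proof.
by apply/eqP => s0; have := s_sq x; rewrite s0 mul0r => /esym/eqP; rewrite pnatr_eq0 gtn_eqF.
Qed.

Let s_conj x : (s x)^* = s x.
Proof. by rewrite conj_Creal // complex_real. Qed.

(* The matrix of [P] after conjugation by the square root of [pi]. *)
Let M : 'M[C]_n :=
  \matrix_(i, j) ((adj (enum_val i) (enum_val j))%:R / (s (enum_val i) * s (enum_val j))).

(** Scaling by [s] makes [vec] an isometry from the weighted space onto row vectors with the
    standard Hermitian product; [P] becomes right multiplication by the Hermitian matrix [M]. *)
Let vec f : 'rV[C]_n := \row_i (f (enum_val i) * s (enum_val i)).

Let sum_enum (F : V -> C) : \sum_(i < n) F (enum_val i) = \sum_x F x.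
Proof.
rewrite [RHS](reindex (fun i : 'I_n => enum_val i)) //.
exact: onW_bij (@enum_val_bij V).
Qed.

Let vec_inj : injective vec.
Proof.
move=> f g fg; apply/ffunP => x; apply: (mulIf (s_neq0 x)).
by have /rowP/(_ (enum_rank x)) := fg; rewrite !mxE enum_rankK.
Qed.

Let vec_surj v : exists f, vec f = v.
Proof.
exists [ffun x => v 0 (enum_rank x) / s x]; apply/rowP => i.
by rewrite !mxE ffunE enum_valK divfK.
Qed.

Let vecM f : vec f *m M = vec (Pop adj f).
Proof.
apply/rowP => j; rewrite !mxE ffunE; set y := enum_val j.
under eq_bigr do rewrite !mxE.
rewrite (sum_enum (fun x => f x * s x * ((adj x y)%:R / (s x * s y)))).
rewrite -s_sq mulrAC (_ : (s y * s y)^-1 * s y = (s y)^-1); last by field; exact: s_neq0.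
rewrite mulr_sumr [RHS]big_mkcond; apply: eq_bigr => x _; rewrite adj_sym.
case: (adj y x); last by rewrite mul0r mulr0.
by rewrite mulr1n; field; rewrite !s_neq0.
Qed.

Let dot_vec f g :
  (vec f *m (vec g)^t*) 0 0 = l2inner (pi_meas adj R) f g.
Proof.
rewrite mxE /l2inner -sum_enum; apply: eq_bigr => i _.
rewrite !mxE rmorphM /= s_conj /pi_meas rmorph_nat -s_sq; set x := enum_val i.
rewrite (_ : (g x)^*%C = (g x)^*) //; ring.
Qed.

Let M_herm : M^t* = M.
Proof.
apply/matrixP => i j; rewrite !mxE rmorphM fmorphV rmorphM /= !s_conj conjC_nat.
by rewrite adj_sym [s _ * _]mulrC.
Qed.

Let one : {ffun V -> C} := [ffun=> 1].

Let Pop_one : Pop adj one = one.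
Proof.
apply/ffunP => x; rewrite !ffunE; under eq_bigr do rewrite ffunE.
by rewrite sumr_const mulVf // pnatr_eq0 gtn_eqF.
Qed.

Let m : C := \sum_x (deg adj x)%:R.

Let dot_one : vec one *m (vec one)^t* = m%:M.
Proof.
apply/matrixP => i j; rewrite !ord1 dot_vec mxE /l2inner; apply: eq_bigr => x _.
by rewrite !ffunE conjc1 !mulr1 /pi_meas rmorph_nat.
Qed.

Let l2oP f : W f <-> vec f *m (vec one)^t* = 0.
Proof.
split => [fW|f0 a].
  by apply/matrixP => i j; rewrite !ord1 dot_vec [RHS]mxE; exact: fW.
have /matrixP/(_ 0 0) := f0; rewrite dot_vec mxE => h.
apply: etrans (_ : l2inner (pi_meas adj R) f one * a^*%C = _); last by rewrite h mul0r.
rewrite mulr_suml; apply: eq_bigr => x _.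
by rewrite !ffunE conjc1 mulr1.
Qed.

(** As [P] is self-adjoint, the left side is the form of [P^2] at [f], which the largest eigenvalue
    on [W] bounds. *)
Lemma srw_gap (b : R) : 0 <= b ->
  (forall a, spectrum_on W (iter 2 (Pop adj)) a -> a <= b%:C%C) ->
  forall f, W f ->
    l2inner (pi_meas adj R) (Pop adj f) (Pop adj f) <=
    b%:C%C * l2inner (pi_meas adj R) f f.
Proof.
move=> b0 spec f Wf.
(* The total mass [m] is inverted below, so the empty vertex set is treated apart. *)
have [x0|V0] := pickP (fun _ : V => true); last first.
  rewrite /l2inner !big1 ?mulr0 // => x; by have := V0 x.
move=> _.
have m0 : m != 0.
  rewrite /m -natr_sum pnatr_eq0 (bigD1 x0) //= addn_eq0 negb_and.
  by rewrite -lt0n deg_gt0.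
(* Subtracting the projection onto the constants moves their eigenvalue to 0. *)
pose K := M *m M - m^-1 *: ((vec one)^t* *m vec one).
have KH : K^t* = K.
  rewrite /K linearB /= map_mxB trmx_mul map_mxM M_herm linearZ /= map_mxZ.
  rewrite trmx_mul map_mxM trmxCK; congr (_ - _ *: _).
  rewrite fmorphV /= conj_Creal // /m; apply: rpred_sum => x _; exact: realn.
have oneK : vec one *m K = 0.
  rewrite /K mulmxBr mulmxA !vecM !Pop_one -scalemxAr mulmxA dot_one mul_scalar_mx.
  by rewrite scalerA mulVf // scale1r subrr.
have Kone : K *m (vec one)^t* = 0.
  by rewrite -KH -map_mxM -trmx_mul oneK trmx0 map_mx0.
have K_herm : K \is hermsymmx.
  by apply/is_hermitianmxP; rewrite expr0 scale1r KH.
have Kvec h : W h -> vec h *m K = vec (iter 2 (Pop adj) h).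
  move=> /l2oP Wh; rewrite /K mulmxBr mulmxA !vecM -scalemxAr mulmxA Wh.
  by rewrite mul0mx scaler0 subr0.
have Keig a : eigenvalue K a -> a <= b%:C%C.
  move=> /eigenvalueP [v Ev v0].
  (* The eigenvalue 0, which includes the constants, is covered by [0 <= b]. For any other, [Kone]
     forces the eigenvector to be orthogonal to [one], hence to come from [W]. *)
  have [->|a0] := eqVneq a 0; first by rewrite ler0c.
  have [h hv] := vec_surj v; apply: spec.
  have Wh : W h.
    apply/l2oP; rewrite hv; apply: (scalerI a0).
    by rewrite scalemxAl -Ev -mulmxA Kone mulmx0 scaler0.
  apply: (eigen_in_spectrum (f := h)) => //=; [exact: l2o0|by rewrite !Pop0| |].
    apply: contra_neq v0 => h0; rewrite -hv h0.
    by apply/rowP => i; rewrite !mxE ffunE mul0r.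
  apply: vec_inj; rewrite -[LHS]Kvec // hv Ev -hv.
  by apply/rowP => i; rewrite !mxE ffunE mulrA.
have := hermitian_form_le K_herm Keig (vec f).
rewrite Kvec //= -[vec (Pop _ (Pop _ _))]vecM dot_vec -mulmxA.
rewrite (_ : M *m (vec f)^t* = (vec (Pop adj f))^t*) ?dot_vec //.
by rewrite -vecM trmx_mul map_mxM M_herm.
Qed.

End SpectralGap.

(** * The gap for real functions, and the bound [beta <= 1] *)

Section RealGap.
Variables (R : realType) (V : finType) (adj : rel V).
Hypothesis adj_sym : symmetric adj.
Hypothesis deg_gt0 : forall x, (0 < deg adj x)%N.

Local Notation W := (l2o (pi_meas adj R)).
Implicit Types g : V -> R.

Let cplx g : {ffun V -> R[i]} := [ffun x => (g x)%:C%C].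

Lemma Pop_cplx g : Pop adj (cplx g) = cplx (srw adj g).
Proof.
apply/ffunP => x; rewrite !ffunE /srw rmorphM fmorphV rmorph_nat rmorph_sum /=.
by congr (_ * _); apply: eq_bigr => y _; rewrite ffunE.
Qed.

Lemma l2inner_cplx g :
  l2inner (pi_meas adj R) (cplx g) (cplx g) =
  (\sum_x (deg adj x)%:R * g x ^+ 2)%:C%C.
Proof.
rewrite /l2inner rmorph_sum /=; apply: eq_bigr => x _.
by rewrite !ffunE conjc_real -!rmorphM -mulrA.
Qed.

Lemma l2o_cplx g : \sum_x (deg adj x)%:R * g x = 0 -> W (cplx g).
Proof.
move=> g0 a; rewrite /l2inner.
under eq_bigr do rewrite !ffunE -rmorphM.
by rewrite -mulr_suml -rmorph_sum /= [X in X%:C%C]g0 mul0r.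
Qed.

Lemma srw_gap_real (b : R) : 0 <= b ->
  (forall a, spectrum_on W (iter 2 (Pop adj)) a -> a <= b%:C%C) ->
  forall g, \sum_x (deg adj x)%:R * g x = 0 ->
  \sum_x (deg adj x)%:R * srw adj g x ^+ 2 <=
    b * \sum_x (deg adj x)%:R * g x ^+ 2.
Proof.
move=> b0 spec g /l2o_cplx Wg.
have := srw_gap adj_sym deg_gt0 b0 spec Wg.
by rewrite Pop_cplx !l2inner_cplx -rmorphM lecR.
Qed.

(** If [beta > 1], the prescribed interval is empty, hence so is the spectrum. The gap inequality
    then holds with constant 0 and [P] kills a nonzero element of [W], which puts 0 in the spectrum:
    a contradiction. *)
Lemma spectral_gap_le1 (beta : R) (x y : V) : x != y ->
  spectrum_on W (iter 2 (Pop adj))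
    `<=` [set lambda : R[i] | 0 <= lambda <= (1 - beta)%:C%C] ->
  beta <= 1.
Proof.
move=> xy spec; rewrite leNgt; apply/negP => b1.
have spec0 a : ~ spectrum_on W (iter 2 (Pop adj)) a.
  move=> /spec /= /andP[a0 /(le_trans a0)]; rewrite ler0c; lra.
(* The difference of the unit masses at [x] and [y], divided by the degree so that its weighted sum
   vanishes. *)
pose g z : R := ((z == x)%:R - (z == y)%:R) / (deg adj z)%:R.
have dN0 z : (deg adj z)%:R != 0 :> R by rewrite pnatr_eq0 gtn_eqF.
have g0 : \sum_z (deg adj z)%:R * g z = 0.
  under eq_bigr do rewrite /g mulrC divfK //.
  have sum_pred1 w : \sum_z (z == w)%:R = 1 :> R.
    by rewrite (bigD1 w) //= eqxx big1 ?addr0 // => z /negPf ->.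
  by rewrite sumrB !sum_pred1 subrr.
have Pg0 : Pop adj (cplx g) = 0.
  have := srw_gap_real (lexx 0) (fun a sa => False_ind _ (spec0 a sa)) g0.
  rewrite mul0r => le0.
  have ge0 z : true -> 0 <= (deg adj z)%:R * srw adj g z ^+ 2.
    by move=> _; rewrite mulr_ge0 ?sqr_ge0.
  have /eqP : \sum_z (deg adj z)%:R * srw adj g z ^+ 2 = 0.
    by apply/eqP; rewrite eq_le le0 sumr_ge0.
  rewrite psumr_eq0 // => /allP h.
  rewrite Pop_cplx; apply/ffunP => z; rewrite !ffunE.
  have := h z (mem_index_enum z).
  by rewrite mulf_eq0 (negPf (dN0 z)) sqrf_eq0 /= => /eqP ->.
apply: (spec0 0); apply: (@eigen_in_spectrum _ _ _ _ (cplx g)).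
- exact: l2o0.
- by rewrite /= !Pop0.
- exact: l2o_cplx.
- apply/eqP => /ffunP/(_ x); rewrite !ffunE => /complexI/eqP.
  by rewrite /g eqxx (negPf xy) subr0 mulf_eq0 invr_eq0 (negPf (dN0 x)) oner_eq0.
- by rewrite /= Pg0 Pop0 scale0r.
Qed.

End RealGap.

(** Since [q >= 1], the second term of the minimum is at most [beta / (6 / beta) ^+ 2], that is
    [beta ^+ 3 / 36]; as [beta <= 1], this is below the claimed bound. *)
Lemma cDbeta_le (R : realType) (D : nat) (beta : R) :
  (3 <= D)%N -> 0 < beta <= 1 -> cDbeta D beta <= 3 / 16 * beta ^+ 2.
Proof.
move=> D3 /andP[b0 b1]; rewrite /cDbeta ge_min; apply/orP; right.
have : 3 <= D%:R :> R by rewrite ler_nat.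
move: (D%:R) => d d3; set q := (d - 1) ^+ 4.
have q1 : 1 <= q by rewrite /q exprn_ege1 //; lra.
have q0 : 0 < q by lra.
have r6 : 6 / beta <= 1 + 6 * q / beta.
  have : 6 / beta <= 6 * q / beta by rewrite ler_pM2r ?invr_gt0 //; lra.
  lra.
have s0 : 0 < 6 / beta by rewrite divr_gt0.
rewrite ler_pdivrMr; last by rewrite exprn_gt0 //; lra.
apply: (@le_trans _ _ beta).
  by rewrite -[leRHS]mul1r ler_pM2r // invf_le1.
apply: (@le_trans _ _ (3 / 16 * beta ^+ 2 * (6 / beta) ^+ 2)).
  have -> : 3 / 16 * beta ^+ 2 * (6 / beta) ^+ 2 = 27 / 4 by field; lra.
  lra.
apply: ler_wpM2l; first by rewrite mulr_ge0 ?sqr_ge0.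
by apply: lerXn2r; rewrite ?nnegrE; lra.
Qed.

(** * Iterating the two-step contraction and passing to complex functions *)

Section Decay.
Variables (R : realType) (V : finType) (adj : rel V).
Hypothesis adj_sym : symmetric adj.
Hypothesis deg_ge3 : forall x, (3 <= deg adj x)%N.
Local Notation E := (oedge adj).

Lemma sum_iter_nbw n (f : E -> R) :
  \sum_e iter n (@nbw R V adj) f e = \sum_e f e.
Proof. by elim: n => //= n <-; rewrite sum_nbw. Qed.

(** Each pair of steps gains a factor [q], and a leftover odd step does not increase the energy. *)
Lemma energy_iter_nbw (q : R) : 0 <= q ->
  (forall f : E -> R, \sum_e f e = 0 -> energy (nbw (nbw f)) <= q * energy f) ->
  forall n (f : E -> R), \sum_e f e = 0 ->
  energy (iter n (@nbw R V adj) f) <= q ^+ (n./2) * energy f.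
Proof.
move=> q0 contr n f f0.
(* Strong induction, because the argument descends by two. *)
have [m le_mn] := ubnP n; elim: m n le_mn => // m IH [|[|n]] lt_nm.
- by rewrite expr0 mul1r.
- by rewrite expr0 mul1r /= energy_nbw_le.
rewrite /= exprS -mulrA; apply: le_trans (contr _ _) _.
  by rewrite sum_iter_nbw.
rewrite ler_wpM2l // IH //; move: lt_nm; rewrite !ltnS; exact: ltnW.
Qed.

Lemma Re_Sop (f : {ffun E -> R[i]}) e :
  complex.Re (Sop adj f e) = nbw (fun e => complex.Re (f e)) e.
Proof.
rewrite ffunE /nbw -raddf_sum /=; set z := \sum_(_ | _) _.
rewrite (_ : _^-1 = ((deg adj (origin e))%:R - 1)^-1%:C%C); last first.
  by rewrite fmorphV rmorphB rmorph_nat rmorph1.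
by case: z => a b; simpc.
Qed.

Lemma Im_Sop (f : {ffun E -> R[i]}) e :
  complex.Im (Sop adj f e) = nbw (fun e => complex.Im (f e)) e.
Proof.
rewrite ffunE /nbw -raddf_sum /=; set z := \sum_(_ | _) _.
rewrite (_ : _^-1 = ((deg adj (origin e))%:R - 1)^-1%:C%C); last first.
  by rewrite fmorphV rmorphB rmorph_nat rmorph1.
by case: z => a b; simpc.
Qed.

Lemma Re_iter_Sop n (f : {ffun E -> R[i]}) :
  (fun e => complex.Re (iter n (Sop adj) f e)) =
  iter n (@nbw R V adj) (fun e => complex.Re (f e)).
Proof. by elim: n => //= n <-; apply/funext => e; rewrite Re_Sop. Qed.

Lemma Im_iter_Sop n (f : {ffun E -> R[i]}) :
  (fun e => complex.Im (iter n (Sop adj) f e)) =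
  iter n (@nbw R V adj) (fun e => complex.Im (f e)).
Proof. by elim: n => //= n <-; apply/funext => e; rewrite Im_Sop. Qed.

Lemma l2norm_ReIm (f : {ffun E -> R[i]}) :
  l2norm (U_meas adj R) f =
  Num.sqrt (energy (fun e => complex.Re (f e)) + energy (fun e => complex.Im (f e))).
Proof.
congr (Num.sqrt _).
rewrite (eq_bigr (fun e => complex.Re (f e) ^+ 2 + complex.Im (f e) ^+ 2)).
  by rewrite big_split.
move=> e _; rewrite /U_meas mul1r; case: (f e) => a b /=.
by rewrite sqr_sqrtr // addr_ge0 ?sqr_ge0.
Qed.

Lemma l2o_sum (f : {ffun E -> R[i]}) : l2o (U_meas adj R) f -> \sum_e f e = 0.
Proof.
move=> /(_ 1) f0; rewrite -[RHS]f0; apply: eq_bigr => e _.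
by rewrite ffunE conjc1 mulr1 /U_meas rmorph1 mul1r.
Qed.

(** Real and imaginary parts evolve separately under [nbw], each has sum zero, and their energies
    add up to the squared norm. *)
Lemma l2norm_iter_Sop (r : R) : 0 <= r ->
  (forall f : E -> R, \sum_e f e = 0 -> energy (nbw (nbw f)) <= r * energy f) ->
  forall n (f : {ffun E -> R[i]}), l2o (U_meas adj R) f ->
  l2norm (U_meas adj R) (iter n (Sop adj) f) ^+ 2 <=
    r ^+ (n./2) * l2norm (U_meas adj R) f ^+ 2.
Proof.
move=> r0 contr n f /l2o_sum f0.
have e0 (h : E -> R) : 0 <= energy h by apply: sumr_ge0 => e _; exact: sqr_ge0.
rewrite !l2norm_ReIm !sqr_sqrtr ?addr_ge0 // mulrDr Re_iter_Sop Im_iter_Sop.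
by apply: lerD; apply: energy_iter_nbw => //; rewrite -raddf_sum f0.
Qed.

End Decay.

Theorem corollary1p2 (R : realType) (V : finType) (adj : rel V)
    (adj_sym : symmetric adj) (adj_irr : irreflexive adj)
    (conn : connected_graph adj) (nonbip : ~ bipartite adj)
    (D : nat) (degD : forall x : V, (3 <= deg adj x <= D)%N)
    (beta : R) (beta_gt0 : 0 < beta)
    (specP2 : spectrum_on (l2o (pi_meas adj R)) (iter 2 (Pop adj))
              `<=` [set lambda : R[i] | 0 <= lambda <= (1 - beta)%:C%C])
    (n : nat) (n_ge1 : (1 <= n)%N) :
  (opnorm_on (U_meas adj R) (l2o (U_meas adj R)) (iter n (Sop adj))
   <= ((1 - cDbeta D beta) ^+ (n %/ 4))%:E)%E.
Proof.
have deg3 x : (3 <= deg adj x)%N by have /andP[] := degD x.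
have deg0 x : (0 < deg adj x)%N by apply: leq_trans (deg3 x).
(* The empty graph is vacuously bipartite, so [nonbip] provides a vertex; a neighbour of it is a
   second, distinct vertex, as [spectral_gap_le1] requires. *)
have [x0 _|V0] := pickP (fun _ : V => true); last first.
  by case: nonbip; exists (fun=> true) => x; have := V0 x.
have [y0 xy] : exists y, adj x0 y.
  by have /card_gt0P [y] := deg0 x0; rewrite inE; exists y.
have neq_xy : x0 != y0 by apply: contraTneq xy => ->; rewrite adj_irr.
have D3 : (3 <= D)%N by have /andP[h1 h2] := degD x0; exact: leq_trans h1 h2.
have b1 : beta <= 1 := spectral_gap_le1 adj_sym deg0 neq_xy specP2.
have b01 : 0 < beta <= 1 by rewrite beta_gt0.
have gap : forall g : V -> R, \sum_x (deg adj x)%:R * g x = 0 ->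
    \sum_x (deg adj x)%:R * srw adj g x ^+ 2 <=
    (1 - beta) * \sum_x (deg adj x)%:R * g x ^+ 2.
  apply: srw_gap_real => //; first by lra.
  by move=> a /specP2 /andP[].
have contr := energy_nbw2 adj_sym deg3 b01 gap.
set q := 1 - _ in contr.
have bb : 0 <= beta ^+ 2 <= 1 by rewrite sqr_ge0 expr_le1 // ltW.
have q0 : 0 <= q by rewrite /q; lra.
have q1 : q <= 1 by rewrite /q; lra.
have qc : q <= 1 - cDbeta D beta by have := cDbeta_le D3 b01; rewrite /q; lra.
apply: ge_ereal_sup => _ [f [Wf /= f1] <-]; rewrite lee_fin.
have c0 : 0 <= 1 - cDbeta D beta := le_trans q0 qc.
have nn (h : {ffun oedge adj -> R[i]}) : 0 <= l2norm (U_meas adj R) h by exact: sqrtr_ge0.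
(* The contraction concerns squared norms, so both sides are squared. *)
rewrite -(@ler_pXn2r _ 2) ?nnegrE ?exprn_ge0 //.
apply: le_trans (l2norm_iter_Sop adj_sym deg3 q0 contr n Wf) _.
apply: (@le_trans _ _ (q ^+ n./2)).
  by rewrite ler_piMr ?exprn_ge0 // expr_le1.
(* Twice the floor of [n / 4] is at most the floor of [n / 2], and [q <= 1]; the lowered exponent is
   the one produced by squaring the target. *)
apply: (@le_trans _ _ (q ^+ (n %/ 4 * 2))).
  rewrite ler_wiXn2l // -divn2 leq_divRL // -mulnA; exact: leq_trunc_div.
by rewrite -exprM lerXn2r ?nnegrE.
Qed.
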